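(* Let $F$ be a forest (a simple graph without cycles). Then $\mathrm{ex}^u_e(F,n)\ll n$.
   Context: A hypergraph $H=(E_i:i\in I)$ is a finite list of finite nonempty subsets of $\mathbb{N}$; it is simple if its edges are pairwise distinct; $v(H)=|\bigcup_iE_i|$, $e(H)=|I|$. In the unordered sense, $H$ contains $H'=(E'_i:i\in I')$ if there exist an injection (not necessarily increasing) $\phi:\bigcup H'\to\bigcup H$ and an injection $f:I'\to I$ with $v\in E'_i\Rightarrow\phi(v)\in E_{f(i)}$. $\mathrm{ex}^u_e(F,n)$ is the maximum of $e(H)$ over simple hypergraphs $H$ with $v(H)\le n$ not containing $F$ in the unordered sense. $f\ll g$ means $|f(n)|<c|g(n)|$ for a constant $c>0$ and all large $n$. *)

(* Defs.v *)
From HB Require Import structures.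
From mathcomp Require Import all_boot all_order all_algebra finmap.
From mathcomp Require Import boolp classical_sets reals.

Set Implicit Arguments.
Unset Strict Implicit.
Unset Printing Implicit Defensive.

Import Order.TTheory GRing.Theory Num.Theory.

(* The index set of the list is 'I_(e H); repeated edges are allowed. *)
Record hypergraph := Hypergraph {
  edges : seq {fset nat};
  _ : fset0 \notin edges
}.

Definition e (H : hypergraph) : nat := size (edges H).

Definition edge (H : hypergraph) (i : 'I_(e H)) : {fset nat} :=
  nth fset0 (edges H) i.

Definition vertices (H : hypergraph) : {fset nat} :=
  (\bigcup_(E <- edges H) E)%fset.

Definition v (H : hypergraph) : nat := #|` vertices H|.

Definition simple (H : hypergraph) : Prop := uniq (edges H).

Definition ucontains (H H' : hypergraph) : Prop :=
  exists (phi : vertices H' -> vertices H) (f : 'I_(e H') -> 'I_(e H)),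
    [/\ injective phi, injective f &
        forall (i : 'I_(e H')) (x : vertices H'),
          val x \in edge i -> val (phi x) \in edge (f i)].

Definition simple_graph (F : hypergraph) : Prop :=
  simple F /\ (forall E, E \in edges F -> #|` E| = 2).

Definition adjacent (F : hypergraph) : rel nat :=
  fun x y => [fset x; y]%fset \in edges F.

Definition forest (F : hypergraph) : Prop :=
  simple_graph F /\
  (forall c : seq nat, 3 <= size c -> ~ ucycle (adjacent F) c).

Definition maximum (A : set nat) (m : nat) : Prop :=
  A m /\ (forall k, A k -> k <= m).

Definition avoiding_sizes (F : hypergraph) (n : nat) : set nat :=
  fun m => exists H : hypergraph,
    [/\ simple H, v H <= n, ~ ucontains H F & e H = m].

(* The maximum exists unless F has no edges (see ex_ueP); in that degenerate
   case every H contains F and the value is 0 by convention. *)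
Definition ex_ue (F : hypergraph) (n : nat) : nat :=
  xget 0 (maximum (avoiding_sizes F n)).

Definition ll (R : realType) (f g : nat -> R) : Prop :=
  exists c : R, (0 < c)%R /\
    exists N : nat, forall n : nat, N <= n -> (`|f n| < c * `|g n|)%R.

Lemma simple_e_le (H : hypergraph) : simple H -> e H <= 2 ^ v H.
Proof.
move=> sH; rewrite /v -card_fpowerset; apply: uniq_leq_size => // E EH.
by rewrite fpowersetE; apply: bigfcup_sup.
Qed.

Lemma ex_ueP (F : hypergraph) (n : nat) :
  0 < e F -> maximum (avoiding_sizes F n) (ex_ue F n).
Proof.
move=> F0; have nil0 : fset0 \notin ([::] : seq {fset nat}) by [].
have A0 : exists m, `[< avoiding_sizes F n m >].
  exists 0; apply/asboolP; exists (Hypergraph nil0); split=> //.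
    by rewrite /v /vertices big_nil cardfs0.
  by case=> [phi [f _]]; case: (f (Ordinal F0)).
have Ab m : `[< avoiding_sizes F n m >] -> m <= 2 ^ n.
  move=> /asboolP[H [sH vH _ <-]]; apply: (leq_trans (simple_e_le sH)).
  by rewrite leq_exp2l.
case: (ex_maxnP A0 Ab) => m /asboolP Am mmax.
apply: (@xgetPex _ 0 (maximum (avoiding_sizes F n))).
by exists m; split=> // k Ak; apply: mmax; apply/asboolP.
Qed.

(* Main.v *)
Require Import Defs.
From HB Require Import structures.
From mathcomp Require Import all_boot all_order all_algebra finmap.
From mathcomp Require Import boolp classical_sets reals.

(** Repeatedly deleting a vertex of degree less than [d], together with the
    edges through it, turns a simple hypergraph with more than [d n] edges on
    [n] vertices into a nonempty one of minimum degree at least [d]. Such a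
    hypergraph contains the forest [F] as soon as [d >= e(F) + 2 ^ v(F)]: embed
    [F] leaf by leaf. When the neighbour of the new leaf has been sent to [u],
    at most [e(F) - 1] of the edges through [u] are already used and at most
    [2 ^ v(F)] of them consist of used vertices only, so some unused edge
    through [u] contains a fresh vertex, to which the leaf is sent. *)

Import GRing.Theory Num.Theory.
Local Open Scope fset_scope.

Lemma cardfs2_eq (K : choiceType) (A : {fset K}) :
  #|` A| = 2 -> exists x y, x != y /\ A = [fset x; y].
Proof.
move=> A2; have /fset0Pn[x xA] : A != fset0 by rewrite -cardfs_gt0 A2.
move: A2; rewrite (cardfsD1 x) xA => -[/eqP/cardfs1P[y Ay]].
exists x, y; split; last by rewrite -(fsetD1K xA) Ay.
have : y \in A `\ x by rewrite Ay fset11.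
by rewrite in_fsetD1 eq_sym => /andP[].
Qed.

Section Leaf.

Variable G : seq {fset nat}.
Let adj : rel nat := fun x y => [fset x; y] \in G.

Hypothesis card_edge : forall E, E \in G -> #|` E| = 2.
Hypothesis acyclic : forall c : seq nat, 3 <= size c -> ~ ucycle adj c.

(** The first vertex [x] of a longest path is a leaf. A further neighbour [z] of [x] would prolong
    the path if it lay off it, and close a cycle if it lay on it. *)
Lemma exists_leaf : G != [::] ->
  exists x y, [/\ x != y, adj x y & forall E, E \in G -> x \in E -> E = [fset x; y]].
Proof.
move=> G0.
have adjxx x : ~~ adj x x.
  by apply/negP => /card_edge; rewrite fsetUid cardfs1.
have adjC x y : adj x y = adj y x by rewrite /adj fsetUC.
have edgeE E : E \in G -> exists x y, x != y /\ E = [fset x; y].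
  by move=> /card_edge/cardfs2_eq.
pose V := \bigcup_(E <- G) E.
have adjV x y : adj x y -> x \in V.
  by move=> xy; apply/bigfcupP; exists [fset x; y]; rewrite ?andbT ?fset21.
have path_adjV x s : path adj x s -> all (mem V) s.
  by elim: s x => //= y s IH x /andP[xy /IH ->]; rewrite andbT (adjV y x) // adjC.
pose P n := `[< exists x y s, [/\ path adj x (y :: s), uniq (x :: y :: s) & size s = n] >].
have exP : exists n, P n.
  have [E EG] : exists E, E \in G by case: (G) G0 => // E G' _; exists E; rewrite mem_head.
  have [x [y [xy EE]]] := edgeE _ EG.
  exists 0; apply/asboolP; exists x, y, [::]; split=> //=; first by rewrite /adj -EE EG.
  by rewrite inE xy.
have Pb n : P n -> n <= #|` V|.
  move=> /asboolP[x [y [s [pxs us <-]]]].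
  apply: (@leq_trans (size (x :: y :: s))); first by rewrite /= -addn2 leq_addr.
  apply: uniq_leq_size => // z; rewrite inE => /predU1P[->|zs].
    by case/andP: pxs => /adjV.
  by move: zs; have /path_adjV/allP/(_ z) := pxs; apply.
case: (ex_maxnP exP Pb) => n /asboolP[x [y [s [pxs us sn]]]] nmax.
have /andP[xy pys] := pxs.
have xNy : x != y by move: us => /=; rewrite inE negb_or => /andP[/andP[]].
exists x, y; split=> // E EG xE.
have [z xz {xE}EE] : exists2 z, adj x z & E = [fset x; z].
  have [a [b [_ EE]]] := edgeE _ EG.
  move: xE; rewrite EE => /fset2P[] ->; first by exists b; rewrite // /adj -EE.
  by exists a; rewrite 1?fsetUC // adjC /adj -EE.
rewrite EE; congr [fset _; _]; apply/eqP/negPn/negP => zy.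
have [zp|zNp] := boolP (z \in x :: y :: s); last first.
  have /nmax : P n.+1.
    apply/asboolP; exists z, x, (y :: s); split; rewrite /= ?sn //.
      by rewrite adjC xz.
    by rewrite zNp.
  by rewrite ltnn.
move: zp; rewrite !inE (negbTE zy) /=; case/predU1P => [zx|zs].
  by move: xz; rewrite zx; apply/negP.
(* The path up to [z] closes up through the edge joining [z] and [x]; it has at least the three
   vertices [x], [y], [z]. *)
move: pxs us; case/splitPr: zs => p1 p2 pxs us.
apply: (acyclic (x :: y :: rcons p1 z)); first by rewrite /= size_rcons.
apply/andP; split.
  move: pxs; rewrite -cat_rcons /= cat_path => /and3P[-> p _] /=.
  by rewrite rcons_path p last_rcons adjC.
by move: us; rewrite -cat_rcons -!cat_cons cat_uniq => /andP[].
Qed.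

End Leaf.

Lemma min_degree_subhypergraph (d : nat) (V : {fset nat}) (L : seq {fset nat}) :
  uniq L -> (forall E, E \in L -> E `<=` V) -> d * #|` V| < size L ->
  exists (W : {fset nat}) (M : seq {fset nat}),
    [/\ uniq M, {subset M <= L}, 0 < size M, (forall E, E \in M -> E `<=` W)
      & forall x, x \in W -> d <= count (fun E => x \in E) M].
Proof.
have [n] := ubnP #|` V|; elim: n V L => // n IH V L Vn uL LV dL.
have [/allP Vd|/allPn[x xV]] := boolP (all (fun x => d <= count (fun E => x \in E) L) V).
  by exists V, L; split=> //; apply: leq_ltn_trans dL.
rewrite -ltnNge => xd.
have cV : #|` V| = #|` V `\ x|.+1 by rewrite (cardfsD1 x) xV.
have [||E||W [M [uM ML M0 MW Wd]]] := IH (V `\ x) [seq E : {fset nat} <- L | x \notin E].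
- by rewrite -ltnS -cV.
- exact: filter_uniq.
- by rewrite mem_filter => /andP[xE EL]; rewrite fsubsetD1 LV.
(* Deleting [x] lowers the left side of the invariant by [d] and the right side by fewer than
   [d]. *)
- move: dL; rewrite cV mulnS size_filter.
  rewrite -(count_predC (fun E : {fset nat} => x \in E) L) => dL.
  by rewrite -(ltn_add2l d); apply: (leq_trans dL); rewrite leq_add2r ltnW.
exists W, M; split=> // E /ML; by rewrite mem_filter => /andP[].
Qed.

Lemma fset_injection (A B : {fset nat}) : #|` A| <= #|` B| ->
  exists phi : nat -> nat, {in A &, injective phi} /\ {in A, forall x, phi x \in B}.
Proof.
move=> AB; exists (fun x => nth 0 B (index x A)).
have iA x : x \in A -> index x A < size B.
  by move=> xA; apply: leq_trans AB; rewrite index_mem.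
split=> [x y xA yA /eqP|x xA]; last by rewrite mem_nth ?iA.
rewrite nth_uniq ?iA ?fset_uniq // => /eqP Exy.
by rewrite -(nth_index 0 xA) Exy nth_index.
Qed.

Section Embedding.

Variables (d : nat) (W : {fset nat}) (M : seq {fset nat}).
Hypothesis uM : uniq M.
Hypothesis MW : forall E, E \in M -> E `<=` W.
Hypothesis Wd : forall x, x \in W -> d <= count (fun E => x \in E) M.

(** Here [U] stands for the used vertices and [S] for the used edges. Since [M] has no repetitions,
    the [d] edges through [u] cannot all come from [S] and the subsets of [U]. *)
Lemma exists_fresh_edge (u : nat) (U : {fset nat}) (S : seq {fset nat}) :
  u \in W -> size S + 2 ^ #|` U| < d ->
  exists E w, [/\ E \in M, E \notin S, u \in E, w \in E & w \notin U].
Proof.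
move=> uW Ud.
have /allPn[E] : ~~ all (fun E => E \in S ++ fpowerset U) [seq E : {fset nat} <- M | u \in E].
  apply/negP => /allP sub; move: Ud; rewrite ltnNge => /negP; apply.
  apply: (leq_trans (Wd _ uW)); rewrite -size_filter.
  have /uniq_leq_size /(_ sub) := filter_uniq (fun E : {fset nat} => u \in E) uM.
  by rewrite size_cat card_fpowerset.
rewrite mem_filter mem_cat negb_or fpowersetE => /andP[uE EM] /andP[ES].
by move=> /fsubsetPn[w wE wU]; exists E, w.
Qed.

(** Induction on the number of edges. [V] may contain isolated vertices, because deleting a leaf can
    leave its neighbour isolated and that vertex still needs an image. *)
Lemma embed_forest (G : seq {fset nat}) (V : {fset nat}) :
  uniq G -> (forall E, E \in G -> #|` E| = 2) ->
  (forall c : seq nat, 3 <= size c -> ~ ucycle (fun x y => [fset x; y] \in G) c) ->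
  (forall E, E \in G -> E `<=` V) -> #|` V| <= #|` W| ->
  size G + 2 ^ #|` V| <= d ->
  exists (phi : nat -> nat) (f : {fset nat} -> {fset nat}),
    [/\ {in V &, injective phi}, {in V, forall x, phi x \in W},
        {in G &, injective f}, {in G, forall E, f E \in M}
      & forall E x, E \in G -> x \in E -> phi x \in f E].
Proof.
have [n] := ubnP (size G); elim: n G V => // n IH G V Gn uG cG aG GV VW Gd.
(* Without edges, any injection of [V] into [W] will do. *)
have [G0|G0] := eqVneq G [::].
  by have [phi [phii phiW]] := fset_injection _ _ VW; exists phi, id; rewrite G0; split.
have [x [y [xy xyG leaf]]] := exists_leaf _ cG aG G0.
set E0 := [fset x; y] in xyG leaf.
have /fsubsetP E0V := GV _ xyG.
have xV : x \in V by apply: E0V; rewrite fset21.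
have yV : y \in V `\ x by rewrite in_fsetD1 eq_sym xy E0V ?fset22.
have memG' E : (E \in rem E0 G) = (E != E0) && (E \in G).
  by rewrite mem_rem_uniq.
have G'G E : E \in rem E0 G -> E \in G by rewrite memG' => /andP[].
have sG : size G = (size (rem E0 G)).+1.
  by rewrite size_rem // prednK //; case: (G) G0.
have cV : #|` V| = #|` V `\ x|.+1 by rewrite (cardfsD1 x) xV.
have V2 : 2 ^ #|` V `\ x| <= 2 ^ #|` V| by rewrite leq_exp2l // cV.
have xG' E : E \in rem E0 G -> x \notin E.
  by rewrite memG' => /andP[EE0 EG]; apply: contraNN EE0 => /(leaf _ EG) ->.
have [||E /G'G/cG|c c3|E EG'|||phi [f [phii phiW fi fM phif]]] := IH (rem E0 G) (V `\ x).
- by rewrite -ltnS -sG.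
- exact: rem_uniq.
- by [].
- case/andP => cyc uc; apply: (aG c c3); rewrite /ucycle uc andbT.
  by apply: sub_cycle cyc => a b /G'G.
- by rewrite fsubsetD1 xG' // GV // G'G.
- by apply: leq_trans VW; rewrite cV.
- by apply: leq_trans Gd; rewrite sG leq_add.
have [||E [w [EM Ef yE wE wphi]]] :=
    exists_fresh_edge (phi y) (phi @` (V `\ x)) (map f (rem E0 G)).
- exact: phiW.
(* The edge [E0] is not yet embedded, which makes the required inequality strict. *)
- rewrite size_map; apply: leq_trans Gd; rewrite sG ltnS leq_add2l.
  apply: leq_trans V2; rewrite leq_exp2l //.
  by rewrite card_in_imfset.
have Vx z : z \in V -> z != x -> z \in V `\ x by rewrite in_fsetD1 => -> ->.
have Gx z : z \in G -> z != E0 -> z \in rem E0 G by rewrite memG' => -> ->.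
have wphi' z : z \in V -> z != x -> phi z != w.
  by move=> zV zx; apply: contraNneq wphi => <-; apply: in_imfset; apply: Vx.
have Ef' z : z \in G -> z != E0 -> f z != E.
  by move=> zG zE; apply: contraNneq Ef => <-; apply: map_f; apply: Gx.
(* The leaf [x] goes to the fresh vertex [w], and its edge [E0] to [E], which contains both [w] and
   [phi y]. *)
exists (fun z => if z == x then w else phi z), (fun z => if z == E0 then E else f z).
split.
- move=> a b aV bV; have [->|ax] := eqVneq a x; have [->|bx] := eqVneq b x => //.
  + by move/esym/eqP; rewrite (negPf (wphi' _ bV bx)).
  + by move/eqP; rewrite (negPf (wphi' _ aV ax)).
  + by apply: phii; apply: Vx.
- move=> a aV; case: eqVneq => [_|ax]; last by apply/phiW/Vx.
  by move: wE; apply/fsubsetP/MW.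
- move=> a b aG' bG'; have [->|ax] := eqVneq a E0; have [->|bx] := eqVneq b E0 => //.
  + by move/esym/eqP; rewrite (negPf (Ef' _ bG' bx)).
  + by move/eqP; rewrite (negPf (Ef' _ aG' ax)).
  + by apply: fi; apply: Gx.
- by move=> a aG'; case: eqVneq => [_|ax] //; apply/fM/Gx.
- move=> a z aG'; have [->|ax] := eqVneq a E0.
    move=> /fset2P[] ->; first by rewrite eqxx.
    by rewrite eq_sym (negPf xy).
  move=> za; case: eqVneq => [zx|_]; last by apply: phif => //; apply: Gx.
  by move: (xG' a (Gx _ aG' ax)); rewrite -zx za.
Qed.

End Embedding.

(** Passes from maps on edges to maps on indices: [i] goes to the first position of [f (edge i)] in
    [edges H]. Injectivity on indices rests on the simplicity of [F]. *)
Lemma ucontains_of_maps (H F : hypergraph) (phi : nat -> nat)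
    (f : {fset nat} -> {fset nat}) :
  simple F -> {in vertices F &, injective phi} ->
  {in vertices F, forall x, phi x \in vertices H} ->
  {in edges F &, injective f} -> {in edges F, forall E, f E \in edges H} ->
  (forall E x, E \in edges F -> x \in E -> phi x \in f E) ->
  ucontains H F.
Proof.
move=> sF phii phiH fi fH phif.
have eF (i : 'I_(e F)) : edge i \in edges F by apply: mem_nth; exact: ltn_ord.
have lt_f (i : 'I_(e F)) : index (f (edge i)) (edges H) < e H.
  by rewrite index_mem fH.
exists (fun x => [` phiH (val x) (valP x)]), (fun i => Ordinal (lt_f i)); split.
- by move=> x y /(congr1 val) /= /phii E; apply/val_inj/E; apply: valP.
- move=> i j /(congr1 val) /= ij.
  have : f (edge i) = f (edge j).
    by rewrite -(nth_index fset0 (fH _ (eF i))) ij nth_index // fH.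
  move=> /(fi _ _ (eF i) (eF j)) /eqP.
  by rewrite nth_uniq ?ltn_ord // => /eqP/val_inj.
- by move=> i x xi; rewrite [edge (Ordinal _)]nth_index ?fH //=; apply: phif.
Qed.

Lemma avoiding_forest_e_le (F H : hypergraph) :
  forest F -> simple H -> ~ ucontains H F -> e H <= (e F + 2 ^ v F) * v H.
Proof.
move=> [[sF cF] aF] sH; rewrite leqNgt => nH; apply/negP => eH; apply: nH.
have HV E : E \in edges H -> E `<=` vertices H by move=> ?; apply: bigfcup_sup.
have [W [M [uM MH M0 MW Wd]]] := min_degree_subhypergraph _ _ _ sH HV eH.
have [E EM] : exists E, E \in M by case: (M) M0 => // E M' _; exists E; rewrite mem_head.
(* Edges of a hypergraph are nonempty, so [W] has a vertex. *)
have [x xE] : exists x, x \in E.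
  apply/fset0Pn; apply: contraTneq (MH _ EM) => ->.
  by case: H {sH eH HV MH}.
have xW : x \in W by move: xE; apply/fsubsetP/MW.
(* The minimum degree is positive, so each vertex of [W] lies on an edge of [M]. *)
have WH : W `<=` vertices H.
  apply/fsubsetP => z /Wd zd.
  have : 0 < count (fun E : {fset nat} => z \in E) M.
    by apply: leq_trans zd; rewrite addn_gt0 expn_gt0 orbT.
  by rewrite -has_count => /hasP[E' /MH/HV/fsubsetP] /[apply].
(* The edges through [x] are distinct subsets of [W], and there are at least [2 ^ v F] of them. *)
have VW : v F <= #|` W|.
  rewrite -(@leq_exp2l 2) // -card_fpowerset.
  apply: (leq_trans (leq_addl (e F) _)); apply: (leq_trans (Wd _ xW)).
  apply: (leq_trans (count_size _ _)); apply: uniq_leq_size => // E' /MW.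
  by rewrite fpowersetE.
have FV E' : E' \in edges F -> E' `<=` vertices F by move=> ?; apply: bigfcup_sup.
have [phi [f [phii phiW fi fM phif]]] :=
  embed_forest _ _ _ uM MW Wd _ _ sF cF aF FV VW (leqnn _).
apply: (ucontains_of_maps _ _ phi f) => // z zF.
- by apply: (fsubsetP WH); apply: phiW.
- exact/MH/fM.
Qed.

Theorem theorem4 (R : realType) (F : hypergraph) (hF : forest F) :
  ll (fun n : nat => (ex_ue F n)%:R%R : R) (fun n : nat => n%:R%R : R).
Proof.
(* The successor turns the bound into a strict one for [n >= 1]. *)
exists ((e F + 2 ^ v F).+1%:R)%R; split; first by rewrite ltr0Sn.
exists 1 => n n0; rewrite !normr_nat -natrM ltr_nat mulSn.
apply: (@leq_ltn_trans ((e F + 2 ^ v F) * n)); last by rewrite -[ltnLHS]add0n ltn_add2r.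
(* If there is no maximum, [ex_ue] takes the default value 0 and the bound is trivial. *)
rewrite /ex_ue; case: xgetP => [m _ [[H [sH vH nH <-]] _]|] //.
by apply: (leq_trans (avoiding_forest_e_le _ _ hF sH nH)); rewrite leq_mul2l vH orbT.
Qed.
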